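(* For all integers $n,m\ge0$, the numbers $\mathcal{B}_{n,m}^{(k)}(a,q,L)$ defined by the generating function below satisfy \[ \mathcal{B}_{n,m}^{(k)}(a,q,L)=\frac{(a+m)^k}{a^k}\sum_{i=0}^{n}\frac{i!\,(-q)^{n-i}\,l^{i+a}}{(a+m+i)^k}\left\{ {n \atop i} \right\}. \]
   Context: Let $k\ge1$ be an integer, $a,q,l_1,\dots,l_k$ nonzero reals, $l=\prod l_i$, $L=(l_1,\dots,l_k)$; denominators $a+j$ ($j\ge0$ integer) assumed nonzero and $l^{a+i}$ means $l^a l^i$. Let $\left\{ {n \atop i} \right\}$ be the Stirling numbers of the second kind and $\operatorname{Li}_k(z;b)=\sum_{n\ge1}\frac{z^n}{(n+b)^k}$. The generalized $m$-poly-Bernoulli numbers are defined by the formal power series identity \[ \frac{q\,l^{a-1}(a+m)^k}{a^k}\,\frac{\operatorname{Li}_k\!\big(\frac{l}{q}(1-e^{-qz});a+m-1\big)}{1-e^{-qz}}=\sum_{n\ge0}\mathcal{B}_{n,m}^{(k)}(a,q,L)\frac{z^n}{n!}. \] *)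

(* Defs.v *)
From HB Require Import structures.
From mathcomp Require Export all_boot all_order all_algebra.
From mathcomp Require Export all_classical all_reals all_analysis.
From mathcomp Require Export complex.

Set Implicit Arguments.
Unset Strict Implicit.
Unset Printing Implicit Defensive.

Import Order.TTheory GRing.Theory Num.Theory.

#[global] Open Scope ring_scope.
#[global] Open Scope complex_scope.

Definition stirling2 (n i : nat) : nat :=
  #|[set P : {set {set 'I_n}} | finset.partition P [set: 'I_n] & #|P| == i]|.

(* A formal power series over F is its sequence of coefficients nat -> F;     *)
(* sums and differences are the pointwise ones.                               *)
Section FormalPowerSeries.
Variable F : fieldType.
Implicit Types f g h : nat -> F.

Definition fps_one : nat -> F := fun n => (n == 0%N)%:R.

Definition fps_scale (c : F) f : nat -> F := fun n => c * f n.

Definition fps_mul f g : nat -> F :=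
  fun n => \sum_(i < n.+1) f i * g (n - i)%N.

Definition fps_pow f (i : nat) : nat -> F := iter i (fps_mul f) fps_one.

(* f(g(z)); meaningful when g has no constant term, since then g^i has order  *)
(* at least i and only the indices i <= n contribute to the coefficient of    *)
(* z^n.                                                                       *)
Definition fps_comp f g : nat -> F :=
  fun n => \sum_(i < n.+1) f i * fps_pow g i n.

(* The series h with h * g = f. It is unique when g <> 0; the value is the    *)
(* zero series if there is none. No condition is put on the constant term of  *)
(* g, which vanishes in the use made below.                                   *)
Definition fps_div f g : nat -> F :=
  xget (fun=> 0) [set h : nat -> F | fps_mul h g = f]%classic.

(* e^(c z) *)
Definition fps_expZ (c : F) : nat -> F := fun n => c ^+ n / n`!%:R.

(* Li_k(z; b) = \sum_(n >= 1) z^n / (n + b)^k *)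
Definition fps_Li (k : nat) (b : F) : nat -> F :=
  fun n => if n == 0%N then 0 else ((n%:R + b) ^+ k)^-1.

End FormalPowerSeries.

Section GenPolyBernoulli.
Variable R : realType.

(* Principal value of x^a for x, a real and x <> 0: for x > 0 it is the usual *)
(* positive real power, for x < 0 it is |x|^a e^(i pi a).                     *)
Definition cpow (x a : R) : R[i] :=
  let t := if x < 0 then a * pi else 0 in
  (`|x| `^ a)%:C * (cos t +i* sin t).

(* x^(a+i) read as x^a x^i, for an integer i. *)
Definition cpow_shift (x a : R) (i : int) : R[i] := cpow x a * x%:C ^ i.

Definition genpolyB_gf (k m : nat) (a q : R) (L : 'I_k -> R) : nat -> R[i] :=
  let l := \prod_(j < k) L j in
  let u := fps_one _ \- fps_expZ (- q%:C) in
  fps_scale (q%:C * cpow_shift l a (-1) * ((a + m%:R) ^+ k / a ^+ k)%:C)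
    (fps_div
       (fps_comp (fps_Li k (a + m%:R - 1)%:C) (fps_scale (l / q)%:C u))
       u).

(* The gf is \sum_n B_n z^n / n!. *)
Definition genpolyB (k n m : nat) (a q : R) (L : 'I_k -> R) : R[i] :=
  n`!%:R * genpolyB_gf m a q L n.

End GenPolyBernoulli.

(* Main.v *)
Require Import Defs.
From mathcomp Require Import ring.
Import Order.TTheory GRing.Theory Num.Theory.

Set Implicit Arguments.
Unset Strict Implicit.
Unset Printing Implicit Defensive.

(** Put [u = 1 - e^(-qz)]. As [Li_k] has no constant term, the quotient in the
generating function is the series [\sum_i c_(i+1) u^i], so only the coefficients
of [u^i] are needed, namely [(-1)^i i! S(n, i) (-q)^n / n!].  Expanding
[e^(-xqz) = (1 - u)^x] by the binomial theorem gives
[x^n (-q)^n / n! = \sum_i 'C(x, i) (-1)^i [z^n]u^i], whereas sorting the maps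
from [n] to [x] points by their kernels gives
[x^n = \sum_i 'C(x, i) i! S(n, i)].  Both hold for every natural number [x],
and the system is unitriangular, which identifies the two families. *)

(** * Maps between finite types, sorted by their kernels *)

Section KernelPartition.
Variables T rT : finType.
Implicit Types (P : {set {set T}}) (f : {ffun T -> rT}).

Definition kernel_partition f : {set {set T}} :=
  preim_partition f [set: T].

Lemma mem_kernel_partition f x y :
  (x \in finset.pblock (kernel_partition f) y) = (f y == f x).
Proof.
rewrite pblock_equivalence_partition ?inE // => a b c _ _ _.
by split=> // /eqP ->.
Qed.

Lemma kernel_partitionE f P : finset.partition P [set: T] ->
  (forall x y, (x \in finset.pblock P y) = (f y == f x)) -> kernel_partition f = P.
Proof.
move=> partP eqP_f.
rewrite -[RHS](equivalence_partition_pblock partP).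
apply: eq_imset => x; apply/setP => y.
by rewrite !inE eqP_f.
Qed.

(** A map with kernel [P] factors through the blocks of [P], and the induced map on blocks is
    injective; conversely each injection of the blocks arises in this way. *)
Lemma card_kernel_partition P : finset.partition P [set: T] ->
  #|[set f | kernel_partition f == P]| = #|rT| ^_ #|P|.
Proof.
move=> partP.
have [/eqP covP tiP _] := and3P partP.
have inP x : finset.pblock P x \in P by rewrite pblock_mem // covP inE.
pose blk x : {B | B \in P} := exist _ (finset.pblock P x) (inP x).
have blk_surj (B : {B | B \in P}) : exists x, blk x = B.
  case: B => B PB.
  have /set0Pn[x Bx] : B != finset.set0.
    by apply: contraTneq PB => ->; case/and3P: partP.
  by exists x; apply: val_inj => /=; apply: def_pblock.
pose F (g : {ffun {B | B \in P} -> rT}) := [ffun x => g (blk x)].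
have Finj : injective F.
  move=> g h /ffunP Fgh; apply/ffunP => B.
  by have [x <-] := blk_surj B; have := Fgh x; rewrite !ffunE.
have eq_blk x y : (x \in finset.pblock P y) = (blk y == blk x).
  by rewrite -val_eqE /= eq_pblock // covP inE.
transitivity #|F @: [set g : {ffun {B | B \in P} -> rT} | injectiveb g]|.
  apply: eq_card => f; rewrite !inE; apply/eqP/imsetP.
    move=> kerf.
    have fP x y : (f y == f x) = (blk y == blk x).
      by rewrite -mem_kernel_partition kerf eq_blk.
    (* The boolean form lets [xchoose] pick a representative of each block, at which [f] is
       evaluated. *)
    have blk_surjb B : exists x, blk x == B.
      by have [x <-] := blk_surj B; exists x.
    pose g := [ffun B => f (xchoose (blk_surjb B))].
    have gb x : g (blk x) = f x.
      by apply/eqP; rewrite ffunE fP (eqP (xchooseP (blk_surjb (blk x)))).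
    exists g; last by apply/ffunP => x; rewrite ffunE gb.
    rewrite inE; apply/injectiveP => B C.
    have [x <-] := blk_surj B; have [y <-] := blk_surj C.
    by rewrite !gb => /eqP; rewrite fP => /eqP.
  case=> g; rewrite inE => /injectiveP injg ->.
  by apply: kernel_partitionE => // x y; rewrite !ffunE (inj_eq injg) eq_blk.
by rewrite card_imset // card_inj_ffuns card_sig.
Qed.

End KernelPartition.

(** * Powers in terms of Stirling numbers of the second kind *)

Lemma stirling2_eq0 n i : (n < i)%N -> stirling2 n i = 0%N.
Proof.
move=> lt_ni; apply/eqP; rewrite cards_eq0; apply/eqP/setP => P.
rewrite !inE; apply/negbTE; apply/negP => /andP[partP /eqP cardP].
have := card_partition partP; rewrite cardsT card_ord => nE.
have [_ _ P0] := and3P partP.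
suff : (#|P| <= n)%N by rewrite cardP leqNgt lt_ni.
rewrite [leqRHS]nE -sum1_card; apply: leq_sum => B PB.
by rewrite card_gt0; apply: contraNneq P0 => <-.
Qed.

Lemma expn_stirling2 x n :
  (x ^ n = \sum_(i < n.+1) x ^_ i * stirling2 n i)%N.
Proof.
transitivity #|{ffun 'I_n -> 'I_x}|; first by rewrite card_ffun !card_ord.
rewrite -sum1_card.
rewrite (partition_big (@kernel_partition _ _)
  (fun P => finset.partition P [set: 'I_n])) /=; last first.
  move=> f _; apply: preim_partitionP.
(* Kernels are grouped by their number of blocks; this number is at most [n], so [inord] preserves
   it. *)
rewrite (partition_big (fun P : {set {set 'I_n}} => inord #|P| : 'I_n.+1) xpredT) //=.
apply: eq_bigr => i _.
have le_n (P : {set {set 'I_n}}) : finset.partition P [set: 'I_n] -> (#|P| < n.+1)%N.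
  move=> partP; rewrite ltnNge; apply/negP => lt_nP.
  have /eqP := stirling2_eq0 lt_nP; rewrite cards_eq0 => /eqP/setP/(_ P).
  by rewrite !inE partP eqxx.
rewrite mulnC -sum_nat_const.
apply: eq_big => [P|P /andP[partP /eqP <-]].
  rewrite inE; case: (boolP (finset.partition P _)) => //= partP.
  by rewrite -val_eqE /= inordK ?le_n.
rewrite inordK ?le_n // -(card_ord x) -card_kernel_partition //.
by rewrite sum1dep_card card_ord.
Qed.

Lemma expn_bin_stirling2 x n :
  (x ^ n = \sum_(i < x.+1) 'C(x, i) * (i`! * stirling2 n i))%N.
Proof.
rewrite expn_stirling2.
under eq_bigr => i _ do rewrite -bin_ffact -mulnA.
pose G i := ('C(x, i) * (i`! * stirling2 n i))%N.
rewrite -(big_mkord xpredT G) -[RHS](big_mkord xpredT G).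
(* [G i] vanishes for [i > x] through the binomial and for [i > n] through the Stirling number, so
   both sums extend to the common bound [n + x]. *)
have ext N : (N <= n + x)%N -> (forall i, (N < i)%N -> G i = 0%N) ->
    (\sum_(0 <= i < N.+1) G i = \sum_(0 <= i < (n + x).+1) G i)%N.
  move=> leN G0; rewrite [RHS](@big_cat_nat _ _ _ N.+1) //=.
  by rewrite [X in _ = (_ + X)%N]big_nat_cond [X in _ = (_ + X)%N]big1 ?addn0 // => i /andP[/andP[/G0]].
rewrite !ext ?leq_addl ?leq_addr // => i lti; rewrite /G.
- by rewrite bin_small.
- by rewrite stirling2_eq0 ?muln0.
Qed.


(** * Products, powers and quotients of formal power series *)

Section FormalPowerSeriesTheory.
Variable F : fieldType.
Implicit Types (f g h : nat -> F) (c : F).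

Lemma fps_mul1f f : fps_mul (fps_one F) f = f.
Proof.
apply/funext => n; rewrite /fps_mul big_ord_recl /= mul1r subn0.
by rewrite big1 ?addr0 // => i _; rewrite /fps_one mul0r.
Qed.

Lemma fps_mulC f g : fps_mul f g = fps_mul g f.
Proof.
apply/funext => n; rewrite /fps_mul (reindex_inj rev_ord_inj) /=.
by apply: eq_bigr => i _; rewrite mulrC subSS subKn // -ltnS.
Qed.

Lemma fps_mulBl f g h : fps_mul (f \- g) h = fps_mul f h \- fps_mul g h.
Proof.
apply/funext => n; rewrite /fps_mul /= -sumrB.
by apply: eq_bigr => i _; rewrite mulrBl.
Qed.

Lemma fps_scale_mull c f g : fps_mul (fps_scale c f) g = fps_scale c (fps_mul f g).
Proof.
apply/funext => n; rewrite /fps_mul /fps_scale big_distrr /=.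
by apply: eq_bigr => i _; rewrite mulrA.
Qed.

Lemma fps_scale_mulr c f g : fps_mul f (fps_scale c g) = fps_scale c (fps_mul f g).
Proof. by rewrite fps_mulC fps_scale_mull fps_mulC. Qed.

#[local] Arguments fps_pow : simpl never.

Lemma fps_powS f i : fps_pow f i.+1 = fps_mul f (fps_pow f i).
Proof. by []. Qed.

Lemma fps_pow_scale c f i :
  fps_pow (fps_scale c f) i = fps_scale (c ^+ i) (fps_pow f i).
Proof.
elim: i => [|i IH]; first by apply/funext => n; rewrite /fps_scale mul1r.
rewrite !fps_powS IH fps_scale_mull fps_scale_mulr.
by apply/funext => n; rewrite /fps_scale mulrA -exprS.
Qed.

Lemma fps_pow_order f i n : f 0%N = 0 -> (n < i)%N -> fps_pow f i n = 0.
Proof.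
move=> f0; elim: i n => // i IH n; rewrite ltnS => le_ni.
rewrite fps_powS /fps_mul big_ord_recl f0 mul0r add0r.
apply: big1 => j _; rewrite IH ?mulr0 //=.
by case: n j le_ni => [|n] [j Hj] //= lt_ni; rewrite /bump add1n subSS
  (leq_ltn_trans (leq_subr _ _)).
Qed.

Lemma fps_pow_subr1 f x n :
  fps_pow (fps_one F \- f) x n =
    \sum_(i < x.+1) 'C(x, i)%:R * ((-1) ^+ i * fps_pow f i n).
Proof.
elim: x n => [|x IH] n; first by rewrite big_ord1 /= bin0 !mul1r.
rewrite fps_powS fps_mulBl fps_mul1f /=.
have -> : fps_mul f (fps_pow (fps_one F \- f) x) n =
    \sum_(i < x.+1) 'C(x, i)%:R * ((-1) ^+ i * fps_pow f i.+1 n).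
  rewrite [LHS]/fps_mul; under eq_bigr => j _ do rewrite IH big_distrr /=.
  rewrite exchange_big /=; apply: eq_bigr => i _.
  rewrite fps_powS /fps_mul !big_distrr /=.
  by apply: eq_bigr => j _; ring.
rewrite IH big_ord_recl [RHS]big_ord_recl !bin0 -addrA; congr (_ + _).
(* The added top term has coefficient ['C(x, x.+1) = 0]; with equal ranges, Pascal's rule applies
   termwise. *)
transitivity (\sum_(i < x.+1) 'C(x, i.+1)%:R * ((-1) ^+ i.+1 * fps_pow f i.+1 n)
   - \sum_(i < x.+1) 'C(x, i)%:R * ((-1) ^+ i * fps_pow f i.+1 n)).
  by rewrite [in RHS]big_ord_recr /= bin_small // mul0r addr0.
rewrite -sumrB; apply: eq_bigr => i _; rewrite /= binS natrD exprS; ring.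
Qed.

(** As [f] has order exactly one, coefficient [n.+1] of the product is [g n * f 1] plus terms in the
    earlier coefficients of [g]. *)
Lemma fps_mul_inj f : f 0%N = 0 -> f 1%N != 0 -> injective (fun g => fps_mul g f).
Proof.
move=> f0 f1 g h eq_gh; apply/funext => n.
elim/ltn_ind: n => n IH.
have := congr1 (@^~ n.+1) eq_gh; rewrite /fps_mul /=.
rewrite !big_ord_recr /= subnn f0 !mulr0 !addr0 subSn // subnn.
rewrite (eq_bigr (fun i : 'I_n => h i * f (n.+1 - i)%N)) => [/addrI|i _].
  by apply: mulIf.
by rewrite IH.
Qed.

(* Dividing [f(c u)] by [u] removes one factor [u] from each term. *)
Lemma fps_div_comp_scale f c u n :
  f 0%N = 0 -> u 0%N = 0 -> u 1%N != 0 ->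
  fps_div (fps_comp f (fps_scale c u)) u n =
    \sum_(i < n.+1) f i.+1 * c ^+ i.+1 * fps_pow u i n.
Proof.
move=> f0 u0 u1.
pose h n := \sum_(i < n.+1) f i.+1 * c ^+ i.+1 * fps_pow u i n.
(* Since [u^i] has order at least [i], the cut-off can be made independent of [p], which allows the
   exchange of sums below. *)
have hE N p : (p <= N)%N -> h p = \sum_(i < N.+1) f i.+1 * c ^+ i.+1 * fps_pow u i p.
  move=> le_pN; rewrite /h.
  rewrite (big_ord_widen N.+1 (fun i => f i.+1 * c ^+ i.+1 * fps_pow u i p)) //.
  rewrite big_mkcond /=; apply: eq_bigr => i _; case: ltnP => // lt_pi.
  by rewrite fps_pow_order ?mulr0.
suff hu : fps_mul h u = fps_comp f (fps_scale c u).
  rewrite /fps_div (@xget_unique _ _ _ h) // => g /= gu.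
  by apply: (@fps_mul_inj u) => //; rewrite gu hu.
apply/funext => N; rewrite /fps_comp big_ord_recl f0 mul0r add0r /fps_mul.
under eq_bigr => p _ do rewrite (hE N) -1?ltnS // big_distrl /=.
(* The term [i = N] belongs to [u^(N+1)], which has no coefficient in degree [N]. *)
rewrite exchange_big /= big_ord_recr /= [X in _ + X = _]big1 ?addr0; last first.
  move=> [p lt_pN] _ /=; have [eq_p|ne_p] := eqVneq p N.
    by rewrite eq_p subnn u0 mulr0.
  by rewrite fps_pow_order ?mulr0 ?mul0r // ltn_neqAle ne_p -ltnS.
apply: eq_bigr => i _.
rewrite /= /bump add1n fps_pow_scale /fps_scale.
rewrite fps_powS fps_mulC /fps_mul.
by rewrite !big_distrr /=; apply: eq_bigr => p _; rewrite !mulrA.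
Qed.

End FormalPowerSeriesTheory.

(** * Exponential series and the powers of [1 - e^(cz)] *)

Section ExponentialSeries.
Variable F : numFieldType.
Implicit Types (a b c : F).

Lemma natr_fact_neq0 n : n`!%:R != 0 :> F.
Proof. by rewrite pnatr_eq0 -lt0n fact_gt0. Qed.

Lemma fps_mul_expZ a b : fps_mul (fps_expZ a) (fps_expZ b) = fps_expZ (a + b).
Proof.
apply/funext => n; rewrite /fps_mul /fps_expZ addrC exprDn mulr_suml.
apply: eq_bigr => [[i lt_in]] _ /=; rewrite -mulr_natr.
have <- : ('C(n, i) * (i`! * (n - i)`!))%:R = n`!%:R :> F by rewrite bin_fact.
rewrite !natrM; field.
by rewrite !natr_fact_neq0 pnatr_eq0 -lt0n bin_gt0 -ltnS lt_in.
Qed.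

Lemma fps_pow_expZ c x : fps_pow (fps_expZ c) x = fps_expZ (x%:R * c).
Proof.
elim: x => [|x IH]; last first.
  by rewrite fps_powS IH fps_mul_expZ -natr1; congr fps_expZ; ring.
apply/funext => n; rewrite /fps_expZ mul0r expr0n /fps_pow /= /fps_one.
by case: n => [|n] /=; rewrite ?divr1 ?mul0r.
Qed.

Lemma fps_pow_1subexp c i n :
  fps_pow (fps_one F \- fps_expZ c) i n =
    (-1) ^+ i * i`!%:R * (stirling2 n i)%:R * c ^+ n / n`!%:R.
Proof.
set u := _ \- _.
(* Both sides are the coefficient of [z^n] in [e^(xcz)]. *)
have binomial_sum x : \sum_(j < x.+1) 'C(x, j)%:R * ((-1) ^+ j * fps_pow u j n) =
    \sum_(j < x.+1) 'C(x, j)%:R * (j`!%:R * (stirling2 n j)%:R * c ^+ n / n`!%:R).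
  rewrite -fps_pow_subr1.
  have -> : fps_one F \- u = fps_expZ c by apply/funext => p; rewrite /u /= subKr.
  rewrite fps_pow_expZ /fps_expZ exprMn -natrX (expn_bin_stirling2 x n).
  rewrite natr_sum !big_distrl /=; apply: eq_bigr => j _; rewrite !natrM; ring.
suff -> : fps_pow u i n = (-1) ^+ i * (i`!%:R * (stirling2 n i)%:R * c ^+ n / n`!%:R).
  by ring.
rewrite -[LHS](signrMK i); congr (_ * _).
elim/ltn_ind: i => i IH.
(* At [x = i] the last binomial is 1 and the earlier terms agree by induction. *)
have := binomial_sum i; rewrite !big_ord_recr /= binn !mul1r.
by under eq_bigr => j _ do rewrite IH //; move/addrI.
Qed.

End ExponentialSeries.

Theorem theorem6 (R : realType) (k : nat) (a q : R) (L : 'I_k -> R)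
    (l := \prod_(j < k) L j) (n m : nat) :
  (1 <= k)%N ->
  a != 0 -> q != 0 -> (forall j : 'I_k, L j != 0) ->
  (forall j : nat, a + j%:R != 0) ->
  genpolyB n m a q L =
    ((a + m%:R) ^+ k / a ^+ k)%:C *
    \sum_(i < n.+1)
       i`!%:R * (- q%:C) ^+ (n - i) * cpow_shift l a i
         / ((a + m%:R + i%:R) ^+ k)%:C * (stirling2 n i)%:R.
Proof.
move=> _ a0 q0 L0 _.
have l0 : l != 0 by apply/prodf_neq0 => j _; apply: L0.
have qC0 : q%:C != 0 by rewrite fmorph_eq0.
have lC0 : l%:C != 0 by rewrite fmorph_eq0.
rewrite /genpolyB /genpolyB_gf -/l /= {1}/fps_scale fps_div_comp_scale //=.
- set A := (_ / _)%:C.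
  rewrite !big_distrr /=; apply: eq_bigr => [[i lt_in]] _ /=.
  rewrite fps_pow_1subexp /fps_Li /= /cpow_shift.
  (* The index shift from dividing by [u] absorbs the [- 1] in the parameter of [Li_k]. *)
  have -> : (i.+1%:R + (a + m%:R - 1)%:C) ^+ k = ((a + m%:R + i%:R) ^+ k)%:C.
    rewrite rmorphXn /= -(rmorph_nat (real_complex R)) -rmorphD /=.
    by congr (_%:C ^+ k); rewrite -natr1; ring.
  have -> : (- q%:C) ^+ n = (- q%:C) ^+ (n - i) * ((-1) ^+ i * q%:C ^+ i).
    by rewrite -exprMn mulN1r -exprD subnK.
  have -> : (l / q)%:C = l%:C / q%:C by rewrite rmorphM fmorphV.
  rewrite expr_div_n -exprnP exprN1 !exprS.
  set d := (_ ^+ k)%:C; set s := (-1) ^+ i.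
  (* One sign comes from [u^i], the other from splitting [(-q)^n]. *)
  have ss : s * s = 1 by rewrite -expr2 sqrr_sign.
  have n0 := natr_fact_neq0 R[i] n.
  have qi0 : q%:C ^+ i != 0 by rewrite expf_neq0.
  set D := d^-1.
  rewrite -[RHS]mul1r -ss; field.
  by rewrite n0 qi0 qC0 lC0 signr_eq0 fmorph_eq0 expf_neq0.
- by rewrite /fps_one /fps_expZ /= expr0 divr1 subrr.
(* The linear coefficient of [u] is [q]. *)
- by rewrite /fps_one /fps_expZ /= expr1 divr1 sub0r opprK.
Qed.
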